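(* Let $U$ be a set of $n$ equiangular lines in $\mathbb{R}^d$ with common angle $\arccos(1/5)$ and base size $5$. Then $$n \leq \max\left\{276, \left\lfloor \frac{4d+36}{3} \right\rfloor\right\}.$$
   Context: A set of lines through the origin in $\mathbb{R}^d$ is equiangular with common angle $\arccos(\alpha)$ if any two distinct lines form the angle $\arccos(\alpha)$. Given such a set $U=\{\mathbb{R}\mathbf{u}_1,\dots,\mathbb{R}\mathbf{u}_n\}$ with unit vectors $\mathbf{u}_i$, the Gram matrix of $\mathbf{u}_1,\dots,\mathbf{u}_n$ equals $I+\alpha S$ for a Seidel matrix $S$ (symmetric, zero diagonal, off-diagonal entries $\pm 1$). For a graph $H$ with adjacency matrix $A(H)$ put $S(H)=J-I-2A(H)$ ($J$ the all-ones matrix). A graph $H$ is said to be induced by $U$ if $S=S(H)$ for the Seidel matrix $S$ arising from some choice of unit vectors $\mathbf{u}_i$ spanning the lines (different choices of signs and orderings give different graphs). The base size of $U$ is the maximum of the clique numbers of all graphs induced by $U$. *)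

(* Defs.v *)
From HB Require Import structures.
From mathcomp Require Import all_boot all_order all_algebra finmap.
From mathcomp Require Import reals trigo.

Set Implicit Arguments.
Unset Strict Implicit.
Unset Printing Implicit Defensive.

Import Order.TTheory GRing.Theory Num.Theory.

Local Open Scope ring_scope.

Definition dot (R : realType) (d : nat) (u v : 'rV[R]_d) : R :=
  \sum_(i < d) u 0 i * v 0 i.

(* The library norm on row vectors is the sup norm, so Euclidean unit vectors
   are singled out by the dot product. *)
Definition unit_vector (R : realType) (d : nat) (u : 'rV[R]_d) : Prop :=
  dot u u = 1.

Definition is_line (R : realType) (d : nat) (L : {vspace 'rV[R]_d}) : Prop :=
  \dim L = 1%N.

(* Taking the absolute value gives the angle in [0, pi/2], independently of the
   unit vectors chosen on the two lines. *)
Definition lines_angle (R : realType) (d : nat) (L1 L2 : {vspace 'rV[R]_d})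
    (theta : R) : Prop :=
  forall u v : 'rV[R]_d, u \in L1 -> v \in L2 ->
    unit_vector u -> unit_vector v -> acos `|dot u v| = theta.

Definition equiangular (R : realType) (d : nat)
    (U : {fset {vspace 'rV[R]_d}}) (theta : R) : Prop :=
  (forall L, L \in U -> is_line L) /\
  (forall L1 L2, L1 \in U -> L2 \in U -> L1 != L2 -> lines_angle L1 L2 theta).

Record sgraph (n : nat) := SGraph {
  adj :> rel 'I_n;
  adj_sym : symmetric adj;
  adj_irrefl : irreflexive adj
}.

Definition clique (n : nat) (H : sgraph n) (K : {set 'I_n}) : bool :=
  [forall i in K, forall j in K, (i != j) ==> H i j].

Definition clique_number (n : nat) (H : sgraph n) : nat :=
  \max_(K : {set 'I_n} | clique H K) #|K|.

Definition adj_mx (R : realType) (n : nat) (H : sgraph n) : 'M[R]_n :=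
  \matrix_(i, j) (H i j)%:R.

Definition seidel_mx (R : realType) (n : nat) (H : sgraph n) : 'M[R]_n :=
  const_mx 1 - 1%:M - 2%:R *: adj_mx R H.

Definition gram_mx (R : realType) (d n : nat) (u : 'I_n -> 'rV[R]_d) : 'M[R]_n :=
  \matrix_(i, j) dot (u i) (u j).

(* One unit vector on each line of U: as the family is indexed by the
   cardinality of U, hitting every line means hitting it exactly once. *)
Definition unit_spanning_family (R : realType) (d : nat)
    (U : {fset {vspace 'rV[R]_d}}) (u : 'I_#|` U| -> 'rV[R]_d) : Prop :=
  (forall i, unit_vector (u i)) /\
  (forall L, L \in U <-> exists i, L = <[u i]>%VS).

Definition induced_graph (R : realType) (d : nat) (alpha : R)
    (U : {fset {vspace 'rV[R]_d}}) (H : sgraph #|` U|) : Prop :=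
  exists2 u : 'I_#|` U| -> 'rV[R]_d,
    unit_spanning_family u & gram_mx u = 1%:M + alpha *: seidel_mx R H.

Definition is_base_size (R : realType) (d : nat) (alpha : R)
    (U : {fset {vspace 'rV[R]_d}}) (b : nat) : Prop :=
  (exists2 H : sgraph #|` U|, induced_graph alpha H & clique_number H = b) /\
  (forall H : sgraph #|` U|, induced_graph alpha H -> (clique_number H <= b)%N).

(* Main.v *)
(* Fix five unit vectors [p_k] with pairwise inner products [-1/5].  Every other
   line has a unit vector with [|M| <= 2], where [M] is the set of the [k] with
   negative inner product, and [M] empty would give a 6-clique.  Project the
   lines on the orthogonal complement of the [p_k] and rescale by [sqrt (5/2)].
   The lines with [|M| = 1] become vectors of squared norm 4/3 with inner
   products at most -1/3, so there are at most five of them.  The lines with a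
   given [M] of size 2 (a "pillar"; there are ten of them) become vectors of
   squared norm 2 with inner products 0 or -1, so their Gram matrix is [2 - A]
   for a graph adjacency matrix [A], and the graph has no triangle since a
   triangle would yield a 6-clique.  Inner products between different pillars
   are 1/3 or -2/3, up to a common sign.

   Write [K = \sum a^T a] for the [N] vectors [a] of a pillar.  Then
   [0 <= K <= 4], and the first three moments of [K] only depend on [N] and on
   the number of edges.  Nonnegativity of [\tr ((2 - K) (4 - K) (2 - K))] gives
   [3 N <= 4 d], which settles the case of one nonempty pillar.  For two
   pillars with operators [K] and [H], the inequality
   [\tr ((K + H) (K - H)^2) <= 8 \tr (K - H)^2] excludes that both have 26
   vectors; cruder estimates exclude the sizes 42 and 22, and 73 and 1.  Hence
   the pillars contain at most [max (72 + 9 * 21) (41 + 9 * 25) = 266] lines,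
   and [5 + 5 + 266 = 276]. *)

Require Import Defs.
From HB Require Import structures.
From mathcomp Require Import all_boot all_order all_algebra finmap.
From mathcomp Require Import reals trigo.
From mathcomp Require Import ring lra zify.

Set Implicit Arguments.
Unset Strict Implicit.
Unset Printing Implicit Defensive.

Import Order.TTheory GRing.Theory Num.Theory.

Local Open Scope ring_scope.

(** * Inner products, Gram matrices and pillars *)

Lemma dotE (R : realType) d (u v : 'rV[R]_d) : dot u v = (u *m v^T) 0 0.
Proof. by rewrite mxE; apply: eq_bigr => i _; rewrite mxE. Qed.

Lemma dotC (R : realType) d (u v : 'rV[R]_d) : dot u v = dot v u.
Proof. by apply: eq_bigr => i _; rewrite mulrC. Qed.

Lemma dotDl (R : realType) d (u v w : 'rV[R]_d) :
  dot (u + v) w = dot u w + dot v w.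
Proof. by rewrite !dotE mulmxDl mxE. Qed.

Lemma dotZl (R : realType) d c (u v : 'rV[R]_d) : dot (c *: u) v = c * dot u v.
Proof. by rewrite !dotE -scalemxAl mxE. Qed.

Lemma dotZr (R : realType) d c (u v : 'rV[R]_d) : dot u (c *: v) = c * dot u v.
Proof. by rewrite dotC dotZl dotC. Qed.

Lemma dotBl (R : realType) d (u v w : 'rV[R]_d) :
  dot (u - v) w = dot u w - dot v w.
Proof. by rewrite dotDl -scaleN1r dotZl mulN1r. Qed.

Lemma dotBr (R : realType) d (u v w : 'rV[R]_d) :
  dot w (u - v) = dot w u - dot w v.
Proof. by rewrite dotC dotBl !(dotC w). Qed.

Lemma dot_suml (R : realType) d (I : finType) (P : pred I) (F : I -> 'rV[R]_d)
    (v : 'rV[R]_d) :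
  dot (\sum_(i | P i) F i) v = \sum_(i | P i) dot (F i) v.
Proof.
by rewrite dotE mulmx_suml summxE; apply: eq_bigr => i _; rewrite dotE.
Qed.

Lemma dot_sumr (R : realType) d (I : finType) (P : pred I) (F : I -> 'rV[R]_d)
    (v : 'rV[R]_d) :
  dot v (\sum_(i | P i) F i) = \sum_(i | P i) dot v (F i).
Proof. by rewrite dotC dot_suml; apply: eq_bigr => i _; rewrite dotC. Qed.

Lemma dot_ge0 (R : realType) d (u : 'rV[R]_d) : 0 <= dot u u.
Proof. by apply: sumr_ge0 => i _; rewrite -expr2 sqr_ge0. Qed.

Lemma dot_mulmx (R : realType) m d (u v : 'rV[R]_m) (A : 'M[R]_(m, d)) :
  dot (u *m A) (v *m A) = dot (u *m (A *m A^T)) v.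
Proof. by rewrite !dotE trmx_mul !mulmxA. Qed.

Lemma dot_mulmxr (R : realType) m d (u : 'rV[R]_m) (v : 'rV[R]_d)
    (A : 'M[R]_(m, d)) : dot (u *m A) v = dot u (v *m A^T).
Proof. by rewrite !dotE trmx_mul trmxK mulmxA. Qed.

Lemma mxtrace_dot (R : realType) m d (A B : 'M[R]_(m, d)) :
  \tr (A *m B^T) = \sum_i dot (row i A) (row i B).
Proof.
apply: eq_bigr => i _; rewrite mxE; apply: eq_bigr => j _.
by rewrite !mxE.
Qed.

(* The Gram matrix of the rows is [2 - A] for the adjacency matrix [A] of a
   graph. *)
Definition pillar (R : realType) N d (A : 'M[R]_(N, d)) : Prop :=
  (forall i, (A *m A^T) i i = 2) /\
  (forall i j, i != j -> (A *m A^T) i j = 0 \/ (A *m A^T) i j = - 1).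

Definition pillar_adj (R : realType) N d (A : 'M[R]_(N, d)) : 'M[R]_N :=
  2%:M - A *m A^T.

Definition triangle_free (R : realType) N d (A : 'M[R]_(N, d)) : Prop :=
  forall i j k,
    pillar_adj A i j * pillar_adj A j k * pillar_adj A k i = 0.

Definition mxsum (R : realType) m n (A : 'M[R]_(m, n)) : R :=
  \sum_i \sum_j A i j.

Lemma mxsum_gram (R : realType) m n d (A : 'M[R]_(m, d)) (B : 'M[R]_(n, d)) :
  mxsum (A *m B^T) = dot (\sum_i row i A) (\sum_i row i B).
Proof.
rewrite dot_suml; apply: eq_bigr => i _; rewrite dot_sumr; apply: eq_bigr=> j _.
by rewrite mxE; apply: eq_bigr => k _; rewrite !mxE.
Qed.

Lemma pillar_adjE (R : realType) N d (A : 'M[R]_(N, d)) (i j : 'I_N) :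
  pillar_adj A i j = 2 *+ (i == j) - (A *m A^T) i j.
Proof. by rewrite /pillar_adj; move: (A *m A^T) => G; rewrite !mxE. Qed.

Lemma pillar_adj01 (R : realType) N d (A : 'M[R]_(N, d)) (i j : 'I_N) :
  pillar A -> pillar_adj A i j = 0 \/ pillar_adj A i j = 1.
Proof.
case=> Aii Aij; rewrite pillar_adjE.
have [->|ij] := eqVneq i j; first by rewrite Aii; left; rewrite mulr1n; lra.
by rewrite mulr0n; case: (Aij i j ij) => ->; [left|right]; lra.
Qed.

Lemma pillar_adjC (R : realType) N d (A : 'M[R]_(N, d)) :
  (pillar_adj A)^T = pillar_adj A.
Proof. by rewrite /pillar_adj linearB /= tr_scalar_mx trmx_mul trmxK. Qed.

Lemma pillar_gramE (R : realType) N d (A : 'M[R]_(N, d)) :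
  A *m A^T = 2%:M - pillar_adj A.
Proof. by rewrite /pillar_adj opprB addrC subrK. Qed.

Lemma mxsum_pillar_gram (R : realType) N d (A : 'M[R]_(N, d)) :
  mxsum (A *m A^T) = 2 * N%:R - mxsum (pillar_adj A).
Proof.
have -> : 2 * N%:R = \sum_(i < N) \sum_(j < N) (2 *+ (i == j) : R).
  under eq_bigr => i _.
    rewrite (bigD1 i) //= eqxx mulr1n big1 ?addr0; last first.
      by move=> j ji; rewrite eq_sym (negPf ji).
    over.
  by rewrite sumr_const card_ord mulr_natr.
rewrite -sumrB; apply: eq_bigr => i _; rewrite -sumrB; apply: eq_bigr => j _.
by rewrite pillar_adjE opprB addrC subrK.
Qed.

(** * Degree sum and spectral bounds of one pillar *)

Lemma mxsum_adj_ge0 (R : realType) N d (A : 'M[R]_(N, d)) :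
  pillar A -> 0 <= mxsum (pillar_adj A).
Proof.
move=> pA; apply: sumr_ge0 => i _; apply: sumr_ge0 => j _.
by case: (pillar_adj01 i j pA) => ->.
Qed.

(** The squared norm of the sum of the rows is nonnegative; for the graph this says that the average
    degree is at most 2. *)
Lemma mxsum_adj_le (R : realType) N d (A : 'M[R]_(N, d)) :
  mxsum (pillar_adj A) <= 2 * N%:R.
Proof. by rewrite -subr_ge0 -mxsum_pillar_gram mxsum_gram dot_ge0. Qed.

(* The off-diagonal Gram entries are nonpositive, so replacing [y] by [|y|]
   turns [0 <= |y| G |y|^T] into [y G y^T <= 4 |y|^2]. *)
Lemma pillar_gram_le4 (R : realType) N d (A : 'M[R]_(N, d)) (y : 'rV[R]_N) :
  pillar A -> dot (y *m A) (y *m A) <= 4 * dot y y.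
Proof.
case=> Aii Aij; pose ay : 'rV[R]_N := \row_i `|y 0 i|.
have expand (z : 'rV[R]_N) : dot (z *m A) (z *m A) =
    \sum_i \sum_j (A *m A^T) j i * z 0 j * z 0 i.
  rewrite dot_mulmx; apply: eq_bigr => i _; rewrite mxE mulr_suml.
  by apply: eq_bigr => j _; rewrite [z 0 j * _]mulrC.
have := dot_ge0 (ay *m A); rewrite !expand => ay_ge0.
(* The comparison is termwise: the diagonal terms agree because [4 - 2 = 2], and an off-diagonal
   entry [g <= 0] satisfies [g |y_j| |y_i| <= - g y_j y_i]. *)
rewrite -subr_ge0; apply: (le_trans ay_ge0).
rewrite mulr_sumr -sumrB; apply: ler_sum => i _.
rewrite [in leRHS](bigD1 i) //= [in leLHS](bigD1 i) //= !mxE.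
rewrite -/((A *m A^T) i i).
have := Aii i; rewrite mxE => ->.
rewrite opprD addrA -sumrN; apply: lerD.
  have := real_normK (num_real (y 0 i)); rewrite !expr2; lra.
apply: ler_sum => j ji; rewrite !mxE.
have := ler_norm (- (y 0 j * y 0 i)); rewrite normrN normrM => yy.
have := ler_norm (y 0 j * y 0 i); rewrite normrM => yy'.
by case: (Aij j i ji); rewrite mxE => ->; lra.
Qed.

(** The bound 4 passes from [A A^T] to [A^T A]. No spectral theory is used: with [z = v A^T],
    expanding [0 <= |4 v - z A|^2] gives [8 |z|^2 <= 16 |v|^2 + |z A|^2], and
    [|z A|^2 <= 4 |z|^2]. *)
Lemma pillar_frame_le4 (R : realType) N d (A : 'M[R]_(N, d)) (v : 'rV[R]_d) :
  pillar A -> dot (v *m A^T) (v *m A^T) <= 4 * dot v v.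
Proof.
move=> pA; set z := v *m A^T.
have := pillar_gram_le4 z pA.
have := dot_ge0 (4 *: v - z *m A).
rewrite dotBl !dotBr !dotZl !dotZr (dotC v) dot_mulmxr -/z; lra.
Qed.

Lemma mxtrace_frame_le4 (R : realType) N d (A : 'M[R]_(N, d)) (D : 'M[R]_d) :
  pillar A -> \tr (D *m (A^T *m A) *m D^T) <= 4 * \tr (D *m D^T).
Proof.
move=> pA; have -> : D *m (A^T *m A) *m D^T = (D *m A^T) *m (D *m A^T)^T.
  by rewrite trmx_mul trmxK !mulmxA.
rewrite !mxtrace_dot mulr_sumr; apply: ler_sum => i _.
by rewrite row_mul pillar_frame_le4.
Qed.

(** * Trace moments of the frame operator *)

Lemma mxtrace_sqr_sym (R : realType) n (A : 'M[R]_n) : A^T = A ->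
  \tr (A *m A) = \sum_i \sum_j A i j ^+ 2.
Proof.
move=> symA; apply: eq_bigr => i _; rewrite mxE; apply: eq_bigr => j _.
by rewrite expr2 -{2}symA mxE.
Qed.

Lemma mxtrace_adj (R : realType) N d (A : 'M[R]_(N, d)) :
  pillar A -> \tr (pillar_adj A) = 0.
Proof.
case=> Aii _; rewrite /mxtrace big1 // => i _.
by rewrite pillar_adjE Aii eqxx mulr1n subrr.
Qed.

Lemma mxtrace_adj2 (R : realType) N d (A : 'M[R]_(N, d)) :
  pillar A -> \tr (pillar_adj A *m pillar_adj A) = mxsum (pillar_adj A).
Proof.
move=> pA; rewrite mxtrace_sqr_sym ?pillar_adjC //.
apply: eq_bigr => i _; apply: eq_bigr => j _.
by case: (pillar_adj01 i j pA) => ->; rewrite expr2 ?mulr0 ?mulr1.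
Qed.

Lemma mxtrace_adj3 (R : realType) N d (A : 'M[R]_(N, d)) :
  triangle_free A ->
  \tr (pillar_adj A *m pillar_adj A *m pillar_adj A) = 0.
Proof.
move=> tf; rewrite /mxtrace big1 // => i _; rewrite mxE big1 // => k _.
by rewrite mxE mulr_suml big1.
Qed.

Lemma mxtrace_frame (R : realType) N d (A : 'M[R]_(N, d)) :
  pillar A -> \tr (A^T *m A) = 2 * N%:R.
Proof.
move=> pA; rewrite mxtrace_mulC pillar_gramE linearB /= mxtrace_adj // subr0.
by rewrite mxtrace_scalar mulr_natr.
Qed.

(** Cyclicity of the trace replaces [A^T A] by the Gram matrix [2 - a], whose powers are expanded in
    the adjacency matrix [a]; the third moment below is computed in the same way. *)
Lemma mxtrace_frame2 (R : realType) N d (A : 'M[R]_(N, d)) :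
  pillar A ->
  \tr (A^T *m A *m (A^T *m A)) = 4 * N%:R + mxsum (pillar_adj A).
Proof.
move=> pA.
have -> : A^T *m A *m (A^T *m A) = A^T *m ((A *m A^T) *m A).
  by rewrite !mulmxA.
rewrite mxtrace_mulC -(mulmxA (A *m A^T)) !pillar_gramE.
move: (mxtrace_adj pA) (mxtrace_adj2 pA); move: (mxsum (pillar_adj A)) => s.
move: (pillar_adj A) => a tr_a tr_a2.
have -> : (2%:M - a) *m (2%:M - a) = 4%:M - 4 *: a + a *m a.
  rewrite !(mulmxBl, mulmxBr) !mul_scalar_mx !mul_mx_scalar.
  apply/matrixP => i j; rewrite !mxE; ring.
rewrite !(linearB, linearD, linearZ) /= tr_a tr_a2.
rewrite mxtrace_scalar -mulr_natr; lra.
Qed.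

Lemma mxtrace_frame3 (R : realType) N d (A : 'M[R]_(N, d)) :
  pillar A -> triangle_free A ->
  \tr (A^T *m A *m (A^T *m A) *m (A^T *m A)) =
  8 * N%:R + 6 * mxsum (pillar_adj A).
Proof.
move=> pA tf.
have -> : A^T *m A *m (A^T *m A) *m (A^T *m A) =
   A^T *m ((A *m A^T) *m (A *m A^T) *m A) by rewrite !mulmxA.
rewrite mxtrace_mulC -(mulmxA (A *m A^T *m (A *m A^T))) !pillar_gramE.
move: (mxtrace_adj pA) (mxtrace_adj2 pA) (mxtrace_adj3 tf).
move: (mxsum (pillar_adj A)) => s; move: (pillar_adj A) => a tr_a tr_a2 tr_a3.
have -> : (2%:M - a) *m (2%:M - a) *m (2%:M - a) =
    8%:M - 12 *: a + 6 *: (a *m a) - a *m a *m a.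
  rewrite !(mulmxBl, mulmxBr) !mul_scalar_mx !mul_mx_scalar.
  rewrite -?scalemxAl -?scalemxAr.
  rewrite ?mulmxA ?mul_scalar_mx -?scalemxAl.
  apply/matrixP => i j; rewrite !mxE; ring.
rewrite !(linearB, linearD, linearZ) /= tr_a tr_a2 tr_a3.
rewrite mxtrace_scalar -mulr_natr; lra.
Qed.

Lemma pillar_size_le (R : realType) N d (A : 'M[R]_(N, d)) :
  pillar A -> triangle_free A -> (3 * N <= 4 * d)%N.
Proof.
move=> pA tf; set K := A^T *m A; pose D : 'M[R]_d := 2%:M - K.
have KC : K^T = K by rewrite /K trmx_mul trmxK.
have := mxtrace_frame_le4 D pA; rewrite -/K.
have -> : D^T = D by rewrite /D linearB /= tr_scalar_mx KC.
have -> : D *m D = 4%:M - 4 *: K + K *m K.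
  rewrite /D !(mulmxBl, mulmxBr) !mul_scalar_mx !mul_mx_scalar.
  apply/matrixP => i j; rewrite !mxE; ring.
have -> : D *m K *m D = 4 *: K - 4 *: (K *m K) + K *m K *m K.
  rewrite /D !(mulmxBl, mulmxBr) !mul_scalar_mx !mul_mx_scalar -!scalemxAl.
  rewrite ?mulmxA ?mul_scalar_mx ?mul_mx_scalar -?scalemxAl.
  apply/matrixP => i j; rewrite !mxE; ring.
rewrite !(linearB, linearD, linearZ) /= mxtrace_scalar.
rewrite mxtrace_frame3 // mxtrace_frame2 // mxtrace_frame //.
(* With [s] the degree sum, the trace inequality reads [2 s <= 4 (4 d - 4 N + s)]; then [s <= 2 N]
   is inserted. *)
have := mxsum_adj_le A; rewrite -mulr_natr => ale ineq.
rewrite -(@ler_nat R) !natrM; lra.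
Qed.

(** * Two crossing pillars *)

Definition crossing (R : realType) m n d (A : 'M[R]_(m, d)) (B : 'M[R]_(n, d)) :
    Prop :=
  forall i j, (A *m B^T) i j = 1 / 3 \/ (A *m B^T) i j = - (2 / 3).

(** The squared Frobenius norm; at [A *m B^T] it equals the trace of the product of the frame
    operators of [A] and [B]. *)
Definition mxsum2 (R : realType) m n (A : 'M[R]_(m, n)) : R :=
  \sum_i \sum_j A i j ^+ 2.

Lemma crossingC (R : realType) m n d (A : 'M[R]_(m, d)) (B : 'M[R]_(n, d)) :
  crossing A B -> crossing B A.
Proof.
move=> AB i j; have := AB j i.
by rewrite -[B *m A^T]trmxK trmx_mul trmxK !mxE.
Qed.

Lemma mxsum2_tr (R : realType) m n (A : 'M[R]_(m, n)) : mxsum2 A^T = mxsum2 A.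
Proof.
rewrite /mxsum2 exchange_big /=; apply: eq_bigr => i _; apply: eq_bigr => j _.
by rewrite mxE.
Qed.

Lemma mxsum2E (R : realType) m n (A : 'M[R]_(m, n)) :
  mxsum2 A = \tr (A *m A^T).
Proof.
apply: eq_bigr => i _; rewrite mxE; apply: eq_bigr => j _.
by rewrite mxE expr2.
Qed.

(** Both admissible entries are roots of [x^2 = (2 - 3 x) / 9], so the sum of squares is affine in
    the plain sum. *)
Lemma mxsum2_crossing (R : realType) m n d
    (A : 'M[R]_(m, d)) (B : 'M[R]_(n, d)) :
  crossing A B ->
  mxsum2 (A *m B^T) = (2 * m%:R * n%:R - 3 * mxsum (A *m B^T)) / 9.
Proof.
move=> AB; have -> : 2 * m%:R * n%:R = \sum_(i < m) \sum_(j < n) (2 : R).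
  by rewrite !sumr_const !card_ord -[_ *+ n]mulr_natr -[_ *+ m]mulr_natr; ring.
rewrite /mxsum mulr_sumr -sumrB mulr_suml; apply: eq_bigr => i _.
rewrite mulr_sumr -sumrB mulr_suml; apply: eq_bigr => j _.
by case: (AB i j) => ->; field.
Qed.

(** Each row [b] of [B] contributes [|b A^T|^2 <= 4 |b|^2 = 8]. *)
Lemma mxsum2_le (R : realType) m n d (A : 'M[R]_(m, d)) (B : 'M[R]_(n, d)) :
  pillar A -> pillar B -> mxsum2 (A *m B^T) <= 8 * n%:R.
Proof.
move=> pA [Bii _]; rewrite -mxsum2_tr trmx_mul trmxK mxsum2E mxtrace_dot.
have -> : 8 * n%:R = \sum_(i < n) (8 : R).
  by rewrite sumr_const card_ord mulr_natr.
apply: ler_sum => i _; rewrite row_mul.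
apply: (le_trans (pillar_frame_le4 _ pA)).
have -> : dot (row i B) (row i B) = (B *m B^T) i i.
  by rewrite mxE; apply: eq_bigr => j _; rewrite !mxE.
rewrite Bii; lra.
Qed.

(** Every entry of [A B^T] has square at least 1/9, while the squares add up to at most 8. *)
Lemma crossing_size_le (R : realType) m d
    (A : 'M[R]_(m, d)) (B : 'M[R]_(1, d)) :
  pillar A -> pillar B -> crossing A B -> (m <= 72)%N.
Proof.
move=> pA pB AB; have := mxsum2_le pA pB.
have : m%:R / 9 <= mxsum2 (A *m B^T).
  have -> : m%:R / 9 = \sum_(i < m) \sum_(j < 1) (1 / 9 : R).
    under eq_bigr do rewrite big_ord1.
    by rewrite sumr_const card_ord -[_ *+ m]mulr_natr; ring.
  apply: ler_sum => i _; apply: ler_sum => j _.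
  by case: (AB i j) => ->; rewrite expr2; lra.
by rewrite -(@ler_nat R); lra.
Qed.

(* [0 <= |t a - b|^2] for the sums [a], [b] of the rows of [A] and [B]. *)
Lemma mxsum_crossing_le (R : realType) m n d
    (A : 'M[R]_(m, d)) (B : 'M[R]_(n, d)) (t : R) :
  2 * t * mxsum (A *m B^T) <=
    t ^+ 2 * (2 * m%:R - mxsum (pillar_adj A)) +
    (2 * n%:R - mxsum (pillar_adj B)).
Proof.
rewrite -!mxsum_pillar_gram !mxsum_gram.
set a := \sum_i row i A; set b := \sum_i row i B.
have := dot_ge0 (t *: a - b).
rewrite dotBl !dotBr !dotZl !dotZr (dotC b a) expr2; lra.
Qed.

(** The sum of the entries of [A B^T] is at least 88 by the frame bound, but below 61 by
    [mxsum_crossing_le]. *)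
Lemma no_pillars42_22 (R : realType) d (A : 'M[R]_(42, d)) (B : 'M[R]_(22, d)) :
  pillar A -> pillar B -> crossing A B -> False.
Proof.
move=> pA pB AB; have := mxsum2_le pA pB; rewrite mxsum2_crossing //.
(* The weight 3/4 approximates [sqrt (44 / 84)], the best choice for two edgeless graphs. *)
have := mxsum_crossing_le A B (3 / 4); rewrite expr2.
have := mxsum_adj_ge0 pA; have := mxsum_adj_ge0 pB; lra.
Qed.

(* With [Z] the columns [x] at inner product [-2/3] from the row [a], expand
   [0 <= |a + (1/3) \sum_(x in Z) x|^2]. *)
Lemma crossing_row_le9 (R : realType) m n d
    (A : 'M[R]_(m, d)) (B : 'M[R]_(n, d)) (i : 'I_m) :
  pillar A -> pillar B -> crossing A B ->
  \sum_j (1 - 3 * (A *m B^T) i j) / 3 <= 9.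
Proof.
move=> [Aii _] [Bii Bij] AB.
(* [z] is the indicator function of the set [Z]. *)
pose z j := (1 - 3 * (A *m B^T) i j) / 3; rewrite -/(z _).
have z01 j : z j = 0 \/ z j = 1.
  by rewrite /z; case: (AB i j) => ->; [left|right]; field.
have dAB j : dot (row i A) (row j B) = (1 - 3 * z j) / 3.
  transitivity ((A *m B^T) i j); last by rewrite /z; field.
  by rewrite mxE; apply: eq_bigr => k _; rewrite !mxE.
have dBB j k : dot (row j B) (row k B) = (B *m B^T) j k.
  by rewrite mxE; apply: eq_bigr => l _; rewrite !mxE.
have dAA : dot (row i A) (row i A) = 2.
  by rewrite -(Aii i) mxE; apply: eq_bigr => l _; rewrite !mxE.
pose s := \sum_j z j *: row j B.
have sA : dot (row i A) s = - (2 / 3) * \sum_j z j.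
  rewrite dot_sumr mulr_sumr; apply: eq_bigr => j _; rewrite dotZr dAB.
  by case: (z01 j) => ->; field.
have ss : dot s s <= 2 * \sum_j z j.
  rewrite dot_suml mulr_sumr; apply: ler_sum => j _.
  rewrite dotZl dot_sumr (bigD1 j) //= dotZr dBB Bii mulrDr.
  rewrite -[leRHS]addr0; apply: lerD; first by case: (z01 j) => ->; lra.
  rewrite mulr_sumr; apply: sumr_le0 => k kj; rewrite dotZr dBB.
  have jk : j != k by rewrite eq_sym.
  by case: (z01 j) => ->; case: (z01 k) => ->; case: (Bij j k jk) => ->; lra.
(* The expansion yields [0 <= 2 - (2 / 9) |Z|]; the weight [t = 1/3] minimises
   [2 t^2 - (4 / 3) t]. *)
have := dot_ge0 (row i A - (- (1 / 3)) *: s).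
rewrite dotBl !dotBr !dotZl !dotZr (dotC s) dAA sA; lra.
Qed.

(** With [W = A B^T] the trace is [\tr (W W^T (2 - a))] for the adjacency matrix [a] of the first
    pillar. Two rows of [W] have at most 9 entries [-2/3] each, which bounds their inner product
    below by [(n - 54) / 9]; this is applied to every edge. *)
Lemma mxtrace_frame_crossing (R : realType) m n d
    (A : 'M[R]_(m, d)) (B : 'M[R]_(n, d)) :
  pillar A -> pillar B -> crossing A B ->
  \tr (B^T *m B *m (A^T *m A) *m (A^T *m A)) <=
  2 * mxsum2 (A *m B^T) + mxsum (pillar_adj A) * (54 - n%:R) / 9.
Proof.
move=> pA pB AB; set W := A *m B^T.
have -> : B^T *m B *m (A^T *m A) *m (A^T *m A) =
    (B^T *m B *m A^T *m (A *m A^T)) *m A by rewrite !mulmxA.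
rewrite mxtrace_mulC !mulmxA -(mulmxA _ A) pillar_gramE.
have -> : A *m B^T *m B *m A^T = W *m W^T.
  by rewrite /W trmx_mul trmxK !mulmxA.
rewrite mulmxBr mul_mx_scalar linearB linearZ /= -mxsum2E.
suff : mxsum (pillar_adj A) * (n%:R - 54) / 9 <= \tr (W *m W^T *m pillar_adj A).
  lra.
rewrite mulr_suml mulr_suml; apply: ler_sum => i _.
rewrite mxE mulr_suml mulr_suml; apply: ler_sum => k _.
have /matrixP /(_ i k) := pillar_adjC A; rewrite [LHS]mxE => ->.
suff WW : (n%:R - 54) / 9 <= (W *m W^T) i k.
  by case: (pillar_adj01 i k pA) => ->; lra.
have := crossing_row_le9 i pA pB AB; have := crossing_row_le9 k pA pB AB.
rewrite -/W => zk zi.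
have -> : n%:R - 54 = \sum_(j < n) (1 : R) - 54.
  by rewrite sumr_const card_ord.
(* For indicators [z], [z'] of the entries [-2/3], the product [(1 - 3 z) (1 - 3 z') / 9] is at
   least [(1 - 3 z - 3 z') / 9], as [z z' >= 0]. *)
apply: (@le_trans _ _ (\sum_j ((1 - (1 - 3 * W i j) - (1 - 3 * W k j)) / 9))).
  rewrite -mulr_suml !sumrB.
  by move: zk zi; rewrite -!mulr_suml !sumrB; lra.
rewrite mxE; apply: ler_sum => j _; rewrite [W^T j k]mxE.
by have := AB i j; have := AB k j; rewrite -/W => -[->|->] [->|->]; lra.
Qed.

Lemma mxtrace_conj_sub (R : realType) n (K H : 'M[R]_n) :
  \tr ((K - H) *m K *m (K - H)) =
  \tr (K *m K *m K) - 2 * \tr (H *m K *m K) + \tr (K *m H *m H).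
Proof.
rewrite !(mulmxBl, mulmxBr) !linearB /=.
rewrite (mxtrace_mulC (K *m K) H) (mxtrace_mulC (H *m K) H) !mulmxA.
rewrite (mxtrace_mulC (H *m H) K) !mulmxA; ring.
Qed.

(* Compare [K = A^T A] and [H = B^T B]: as [K, H <= 4], the trace of
   [(K + H) (K - H)^2] is at most [8 \tr (K - H)^2], and the absence of
   triangles makes [\tr K^3] and [\tr H^3] too large for that. *)
Lemma no_pillars26_26 (R : realType) d (A B : 'M[R]_(26, d)) :
  pillar A -> pillar B -> triangle_free A -> triangle_free B ->
  crossing A B -> False.
Proof.
move=> pA pB tfA tfB AB; have BA := crossingC AB.
pose K := A^T *m A; pose H := B^T *m B; pose D : 'M[R]_d := K - H.
have KH : \tr (K *m H) = mxsum2 (A *m B^T).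
  rewrite mxsum2E trmx_mul trmxK /K /H mxtrace_mulC !mulmxA.
  by rewrite (mxtrace_mulC _ A) !mulmxA.
have DC : D^T = D by rewrite /D linearB /= /K /H !trmx_mul !trmxK.
have := mxtrace_frame_le4 D pA; have := mxtrace_frame_le4 D pB.
rewrite DC -/K -/H.
have -> : \tr (D *m D) = \tr (K *m K) - 2 * \tr (K *m H) + \tr (H *m H).
  rewrite /D !(mulmxBl, mulmxBr) !linearB /= (mxtrace_mulC H K); ring.
have := mxtrace_conj_sub H K; rewrite -(opprB K) mulNmx mulNmx mulmxN opprK.
rewrite -/D => ->; have := mxtrace_conj_sub K H; rewrite -/D => ->.
have := mxtrace_frame_crossing pA pB AB.
have := mxtrace_frame_crossing pB pA BA.
rewrite -/K -/H -(mxsum2_tr (B *m A^T)) trmx_mul trmxK.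
rewrite !mxtrace_frame3 // !mxtrace_frame2 // KH mxsum2_crossing //.
(* Let [S] be the sum of both degree sums and [x] the sum of the entries of [A B^T]. The trace
   inequality together with [2 x <= 104 - S] forces [S > 111], whereas [S <= 104]. *)
have := mxsum_adj_le A; have := mxsum_adj_le B.
have := mxsum_crossing_le A B 1; rewrite expr2; lra.
Qed.

(** * Residuals of a simplex and counting *)

Lemma row_gramE (R : realType) m n d (X : 'I_m -> 'rV[R]_d)
    (Y : 'I_n -> 'rV[R]_d) i j :
  ((\matrix_(i < m) X i) *m (\matrix_(j < n) Y j)^T) i j = dot (X i) (Y j).
Proof. by rewrite mxE; apply: eq_bigr => k _; rewrite !mxE. Qed.

Lemma exists_inj_ord (T : finType) (S : {set T}) m : (m <= #|S|)%N ->
  exists2 f : 'I_m -> T, injective f & forall k, f k \in S.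
Proof.
move=> mS; exists (fun k => enum_val (widen_ord mS k)); last first.
  by move=> k; apply: enum_valP.
by move=> j k /enum_val_inj /(congr1 val) /= /val_inj.
Qed.

(** The argument follows the largest term [N i]. If another term is nonzero, then [N i <= 72], which
    suffices when the other nine are at most 21. Otherwise [N i <= 41], and a further term of at
    least 26 would force [N i <= 25], against maximality. *)
Lemma sum_pillars_le (I : finType) (S : {set I}) (N : I -> nat) :
  #|S| = 10%N ->
  (forall i j, i \in S -> j \in S -> i != j -> 0 < N j -> N i <= 72)%N ->
  (forall i j, i \in S -> j \in S -> i != j -> 22 <= N j -> N i <= 41)%N ->
  (forall i j, i \in S -> j \in S -> i != j -> 26 <= N j -> N i <= 25)%N ->
  (\sum_(i in S) N i <= 266)%N \/
  exists2 i, i \in S & (\sum_(i in S) N i)%N = N i.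
Proof.
move=> S10 N72 N41 N25.
have /card_gt0P[i0 i0S] : (0 < #|S|)%N by rewrite S10.
have [i iS imax] := @arg_maxnP _ i0 (mem S) N i0S.
have S9 : #|[pred j in S | j != i]| = 9%N.
  have iS' : i \in S := iS.
  have := S10; rewrite (cardD1 i) iS' => -[<-].
  by apply: eq_card => j; rewrite !inE andbC.
have sum_le b : (forall j, j \in S -> j != i -> N j <= b)%N ->
    (\sum_(j in S) N j <= N i + b * 9)%N.
  move=> Nb; rewrite (bigD1 i) //= leq_add2l -S9 mulnC -sum_nat_const.
  by apply: leq_sum => j /andP[jS ji]; apply: Nb.
have [N0|] := boolP [forall (j | (j \in S) && (j != i)), N j == 0%N].
  right; exists i => //; rewrite (bigD1 i) //= big1 ?addn0 // => j jSi.
  by apply/eqP; move/forall_inP: N0; apply.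
move/forall_inPn => [j /andP[jS ji]]; rewrite -lt0n => Nj; left.
have Ni : (N i <= 72)%N by apply: (N72 i j) => //; rewrite eq_sym.
have [N21|] := boolP [forall (k | (k \in S) && (k != i)), N k <= 21]%N.
  apply: leq_trans (sum_le 21%N _) _; last lia.
  by move=> k kS ki; move/forall_inP: N21; apply; apply/andP.
move/forall_inPn => [k /andP[kS ki]]; rewrite -ltnNge => Nk.
have Ni41 : (N i <= 41)%N by apply: (N41 i k) => //; rewrite eq_sym.
apply: leq_trans (sum_le 25%N _) _; last lia.
move=> l lS li; rewrite leqNgt; apply/negP => Nl.
have := N25 i l iS lS; rewrite eq_sym => /(_ li Nl) Ni25.
by have := imax l lS => /=; lia.
Qed.

(** For [s = #|S|], the squared norm of the sum of the vectors is nonnegative and at most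
    [s (5 - s) / 3]. *)
Lemma acute_size_le5 (R : realType) d (I : finType) (S : {set I})
    (w : I -> 'rV[R]_d) :
  (forall i, i \in S -> dot (w i) (w i) = 4 / 3) ->
  (forall i j, i \in S -> j \in S -> i != j -> dot (w i) (w j) <= - (1 / 3)) ->
  (#|S| <= 5)%N.
Proof.
move=> wii wij; have := dot_ge0 (\sum_(i in S) w i).
suff H : dot (\sum_(i in S) w i) (\sum_(i in S) w i) <=
    #|S|%:R * (5 / 3 - #|S|%:R / 3).
  rewrite -(@ler_nat R) => /le_trans/(_ H).
  have := ler0n R #|S|; rewrite le_eqVlt => /orP[/eqP <-|S0]; first by lra.
  by rewrite pmulr_rge0 //; lra.
rewrite mulr_natl -sumr_const dot_suml; apply: ler_sum => i iS.
rewrite dot_sumr (bigD1 i) //= wii //.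
have : \sum_(j in S | j != i) dot (w i) (w j) <=
       \sum_(j in S | j != i) (- (1 / 3)).
  by apply: ler_sum => j /andP[jS ji]; apply: wij => //; rewrite eq_sym.
have -> : \sum_(j in S | j != i) (- (1 / 3) : R) = - (1 / 3) * (#|S|%:R - 1).
  apply: (@addrI _ (- (1 / 3))); rewrite -(bigD1 i (F := fun=> - (1 / 3))) //.
  by rewrite sumr_const -[_ *+ #|S|]mulr_natr; ring.
lra.
Qed.

(** A rescaled orthogonal projection: the Gram matrix [(6/5) I - (1/5) J] of the simplex [p] has
    inverse [(5/6) (I + J)], which gives the coefficients. The factor [sqrt (5/2)] gives pillar
    vectors squared norm 2. *)
Definition residual (R : realType) d (p : 'I_5 -> 'rV[R]_d) (x : 'rV[R]_d) :
    'rV[R]_d :=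
  Num.sqrt (5 / 2) *:
    (x - \sum_k (5 / 6 * (dot x (p k) + \sum_l dot x (p l))) *: p k).

Lemma dot_residual (R : realType) d (p : 'I_5 -> 'rV[R]_d) (x y : 'rV[R]_d) :
  (forall k, dot (p k) (p k) = 1) ->
  (forall k l, k != l -> dot (p k) (p l) = - (1 / 5)) ->
  dot (residual p x) (residual p y) =
  5 / 2 * dot x y -
  25 / 12 * (\sum_k dot x (p k) * dot y (p k) +
             (\sum_k dot x (p k)) * \sum_k dot y (p k)).
Proof.
move=> pkk pkl; rewrite /residual dotZl dotZr.
pose c z k := 5 / 6 * (dot z (p k) + \sum_l dot z (p l)).
set rx := x - _; set ry := y - _.
have sum_c z : \sum_k c z k = 5 * \sum_l dot z (p l).
  by rewrite -mulr_sumr big_split /= sumr_const card_ord -mulr_natr; field.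
(* Since [ry] is orthogonal to the simplex, [rx] can then be replaced by [x]. *)
have pry l : dot (p l) ry = 0.
  rewrite dotBr dot_sumr; under eq_bigr do rewrite dotZr -/(c y _).
  have -> : \sum_k c y k * dot (p l) (p k) =
      - (1 / 5) * \sum_k c y k + 6 / 5 * c y l.
    rewrite mulr_sumr (bigD1 l) //= pkk [in RHS](bigD1 l) //=.
    rewrite (eq_bigr (fun k => - (1 / 5) * c y k)); last first.
      by move=> k kl; rewrite pkl 1?eq_sym // mulrC.
    by rewrite [RHS]addrAC; congr (_ + _); field.
  by rewrite sum_c /c (dotC (p l)); field.
have -> : dot rx ry = dot x ry.
  by rewrite dotBl dot_suml big1 ?subr0 // => k _; rewrite dotZl pry mulr0.
rewrite mulrA -expr2 sqr_sqrtr; last by lra.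
rewrite dotBr dot_sumr.
have -> : \sum_k dot x (c y k *: p k) =
    5 / 6 * (\sum_k dot x (p k) * dot y (p k) +
             (\sum_k dot x (p k)) * \sum_k dot y (p k)).
  rewrite mulr_suml -big_split mulr_sumr; apply: eq_bigr => k _.
  by rewrite dotZr /c /=; ring.
by field.
Qed.

Lemma dot_residual_pattern (R : realType) d (p : 'I_5 -> 'rV[R]_d)
    (x y : 'rV[R]_d) (M L : {set 'I_5}) :
  (forall k, dot (p k) (p k) = 1) ->
  (forall k l, k != l -> dot (p k) (p l) = - (1 / 5)) ->
  (forall k, dot x (p k) = (1 - 2 * (k \in M)%:R) / 5) ->
  (forall k, dot y (p k) = (1 - 2 * (k \in L)%:R) / 5) ->
  dot (residual p x) (residual p y) =
  5 / 2 * dot x y -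
  (5 - 2 * #|M|%:R - 2 * #|L|%:R + 4 * #|M :&: L|%:R +
   (5 - 2 * #|M|%:R) * (5 - 2 * #|L|%:R)) / 12.
Proof.
move=> pkk pkl xM yL; rewrite dot_residual //.
have card_sum (Q : {set 'I_5}) : #|Q|%:R = \sum_k (k \in Q)%:R :> R.
  by rewrite -sum1_card natr_sum big_mkcond; apply: eq_bigr => k _; case: ifP.
have sum_pat (Q : {set 'I_5}) :
    \sum_k (1 - 2 * (k \in Q)%:R) / 5 = (5 - 2 * #|Q|%:R) / 5 :> R.
  by rewrite -mulr_suml sumrB -mulr_sumr -card_sum sumr_const card_ord.
rewrite (eq_bigr _ (fun k _ => xM k)) (eq_bigr _ (fun k _ => yL k)) !sum_pat.
have -> : \sum_k dot x (p k) * dot y (p k) =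
    (5 - 2 * #|M|%:R - 2 * #|L|%:R + 4 * #|M :&: L|%:R) / 25.
  transitivity (\sum_k (1 - 2 * (k \in M)%:R - 2 * (k \in L)%:R
                         + 4 * (k \in M :&: L)%:R) / 25 : R).
    apply: eq_bigr => k _; rewrite xM yL inE.
    by case: (k \in M); case: (k \in L) => /=; field.
  rewrite -mulr_suml big_split !sumrB /= -!mulr_sumr -!card_sum.
  by rewrite sumr_const card_ord.
by field.
Qed.

(** * Systems of lines with a 5-clique *)

(* [q] enumerates a 5-clique of the lines, and [c] in [system_max] ranges over
   the sign choices, i.e. over the graphs induced by the lines. *)
Record clique_system (R : realType) d n
    (u : 'I_n -> 'rV[R]_d) (q : 'I_5 -> 'I_n) : Prop := CliqueSystem {
  system_unit : forall i, dot (u i) (u i) = 1;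
  system_angle : forall i j, i != j ->
    dot (u i) (u j) = 1 / 5 \/ dot (u i) (u j) = - (1 / 5);
  system_inj : injective q;
  system_clique : forall k l, k != l ->
    dot (u (q k)) (u (q l)) = - (1 / 5);
  system_max : forall (c : 'I_n -> R) (S : {set 'I_n}),
    (forall i, c i = 1 \/ c i = - 1) ->
    (forall i j, i \in S -> j \in S -> i != j ->
       c i * c j * dot (u i) (u j) = - (1 / 5)) ->
    (#|S| <= 5)%N
}.

Definition obtuse_set (R : realType) d n (u : 'I_n -> 'rV[R]_d)
    (q : 'I_5 -> 'I_n) (i : 'I_n) : {set 'I_5} :=
  [set k | dot (u i) (u (q k)) < 0].

(** Passing to the opposite vector complements the set of negative products with the five clique
    vectors, so a majority vote leaves at most two of them. *)
Definition line_sign (R : realType) d n (u : 'I_n -> 'rV[R]_d)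
    (q : 'I_5 -> 'I_n) (i : 'I_n) : R :=
  if (2 < #|obtuse_set u q i|)%N then - 1 else 1.

Definition minus_set (R : realType) d n (u : 'I_n -> 'rV[R]_d)
    (q : 'I_5 -> 'I_n) (i : 'I_n) : {set 'I_5} :=
  if (2 < #|obtuse_set u q i|)%N then ~: obtuse_set u q i else obtuse_set u q i.

Lemma line_sign_pm1 (R : realType) d n (u : 'I_n -> 'rV[R]_d) q i :
  line_sign u q i = 1 \/ line_sign u q i = - 1.
Proof. by rewrite /line_sign; case: ifP; [right|left]. Qed.

Lemma line_sign_sqr (R : realType) d n (u : 'I_n -> 'rV[R]_d) q i :
  line_sign u q i * line_sign u q i = 1.
Proof. by case: (line_sign_pm1 u q i) => ->; ring. Qed.

Lemma minus_set_le2 (R : realType) d n (u : 'I_n -> 'rV[R]_d) q i :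
  (#|minus_set u q i| <= 2)%N.
Proof.
rewrite /minus_set; case: ltnP => // o2.
by have := cardsC (obtuse_set u q i); rewrite card_ord; lia.
Qed.

Lemma dot_line_sign (R : realType) d n (u : 'I_n -> 'rV[R]_d) q i k :
  clique_system u q -> i \notin q @: setT ->
  dot (line_sign u q i *: u i) (u (q k)) =
  (1 - 2 * (k \in minus_set u q i)%:R) / 5.
Proof.
move=> sys iq; rewrite dotZl.
have iqk : i != q k by apply: contraNneq iq => ->; rewrite imset_f.
rewrite /line_sign /minus_set; case: ifP => _; rewrite ?inE;
  by case: (system_angle sys iqk) => ->; case: ltP => /=; lra.
Qed.

(** Otherwise the opposite of the signed vector has product -1/5 with all five clique vectors and
    extends them to a 6-clique. *)
Lemma minus_set_neq0 (R : realType) d n (u : 'I_n -> 'rV[R]_d) q i :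
  clique_system u q -> i \notin q @: setT -> (0 < #|minus_set u q i|)%N.
Proof.
move=> sys iq; rewrite lt0n cards_eq0; apply/eqP => M0.
pose c j : R := if j \in q @: setT then 1 else - line_sign u q i.
have c_q k : c (q k) = 1 by rewrite /c imset_f.
have c_i : c i = - line_sign u q i by rewrite /c (negPf iq).
have iqk k : line_sign u q i * dot (u i) (u (q k)) = 1 / 5.
  by rewrite -dotZl dot_line_sign // M0 in_set0 mulr0 subr0.
have := system_max sys (c := c) (S := i |: q @: setT).
rewrite cardsU1 iq card_imset ?cardsT ?card_ord; last exact: system_inj sys.
move=> H; suff : (1 + 5 <= 5)%N by []; apply: H.
  move=> j; rewrite /c; case: ifP => _; first by left.
  by case: (line_sign_pm1 u q i) => ->; [right | left; rewrite opprK].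
move=> j l /setU1P[->|/imsetP[k _ ->]] /setU1P[->|/imsetP[m _ ->]].
- by rewrite eqxx.
- by rewrite c_q c_i mulr1 mulNr iqk.
- by rewrite c_q c_i mul1r mulNr dotC iqk.
- move=> km; rewrite !c_q (system_clique sys); first lra.
  by apply: contraNneq km => ->.
Qed.

Definition line_residual (R : realType) d n (u : 'I_n -> 'rV[R]_d)
    (q : 'I_5 -> 'I_n) (i : 'I_n) : 'rV[R]_d :=
  residual (u \o q) (line_sign u q i *: u i).

Lemma dot_line_residual (R : realType) d n (u : 'I_n -> 'rV[R]_d) q i j :
  clique_system u q -> i \notin q @: setT -> j \notin q @: setT ->
  dot (line_residual u q i) (line_residual u q j) =
  5 / 2 * (line_sign u q i * line_sign u q j * dot (u i) (u j)) -
  (5 - 2 * #|minus_set u q i|%:R - 2 * #|minus_set u q j|%:R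
   + 4 * #|minus_set u q i :&: minus_set u q j|%:R +
   (5 - 2 * #|minus_set u q i|%:R) * (5 - 2 * #|minus_set u q j|%:R)) / 12.
Proof.
move=> sys iq jq.
rewrite (dot_residual_pattern (M := minus_set u q i) (L := minus_set u q j)).
- by rewrite dotZl dotZr mulrA.
- by move=> k; apply: system_unit sys _.
- by move=> k l; apply: system_clique sys _ _.
- by move=> k; apply: dot_line_sign.
- by move=> k; apply: dot_line_sign.
Qed.

Lemma signed_dot_pm (R : realType) d n (u : 'I_n -> 'rV[R]_d) q i j :
  clique_system u q -> i != j ->
  line_sign u q i * line_sign u q j * dot (u i) (u j) = 1 / 5 \/
  line_sign u q i * line_sign u q j * dot (u i) (u j) = - (1 / 5).
Proof.
move=> sys ij; case: (line_sign_pm1 u q i) => ->;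
  case: (line_sign_pm1 u q j) => ->; case: (system_angle sys ij) => ->;
  by [left; lra | right; lra].
Qed.

(** * Pillars of a system of lines *)

Definition pillar_set (R : realType) d n (u : 'I_n -> 'rV[R]_d)
    (q : 'I_5 -> 'I_n) (M : {set 'I_5}) : {set 'I_n} :=
  [set i | (i \notin q @: setT) && (minus_set u q i == M)].

Lemma line_residual_self (R : realType) d n (u : 'I_n -> 'rV[R]_d) q
    (M : {set 'I_5}) i :
  clique_system u q -> #|M| = 2%N -> i \in pillar_set u q M ->
  dot (line_residual u q i) (line_residual u q i) = 2.
Proof.
move=> sys M2; rewrite inE => /andP[iq /eqP iM].
by rewrite dot_line_residual // line_sign_sqr (system_unit sys) iM setIid M2;
  field.
Qed.

(** A signed product 1/5 thus becomes 0 and -1/5 becomes -1: edges of the pillar graph are the pairs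
    with signed product -1/5. *)
Lemma line_residual_pillar (R : realType) d n (u : 'I_n -> 'rV[R]_d) q
    (M : {set 'I_5}) i j :
  clique_system u q -> #|M| = 2%N ->
  i \in pillar_set u q M -> j \in pillar_set u q M -> i != j ->
  dot (line_residual u q i) (line_residual u q j) =
    5 / 2 * (line_sign u q i * line_sign u q j * dot (u i) (u j)) - 1 / 2.
Proof.
move=> sys M2; rewrite !inE => /andP[iq /eqP iM] /andP[jq /eqP jM] ij.
by rewrite dot_line_residual // iM jM setIid M2; field.
Qed.

(* Three lines of a pillar [M] with pairwise residuals at [-1], together with
   the opposites of the three clique vectors outside [M], form a 6-clique. *)
Lemma pillar_set_triangle (R : realType) d n (u : 'I_n -> 'rV[R]_d) q
    (M : {set 'I_5}) i j l :
  clique_system u q -> #|M| = 2%N ->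
  i \in pillar_set u q M -> j \in pillar_set u q M -> l \in pillar_set u q M ->
  i != j -> j != l -> l != i ->
  dot (line_residual u q i) (line_residual u q j) = - 1 ->
  dot (line_residual u q j) (line_residual u q l) = - 1 ->
  dot (line_residual u q l) (line_residual u q i) = - 1 -> False.
Proof.
move=> sys M2 iM jM lM ij jl li.
rewrite !(line_residual_pillar (M := M)) // => dij djl dli.
pose T := [set i; j; l]; pose Q := q @: ~: M.
(* Reversing all clique vectors preserves their mutual products and turns the products 1/5 between
   [T] and [Q] into -1/5. *)
pose c x : R := if x \in q @: setT then - 1 else line_sign u q x.
have T_pillar x : x \in T -> x \in pillar_set u q M.
  by rewrite /T !in_setU !in_set1 => /orP[/orP[]|] /eqP ->.
have c_q k : c (q k) = - 1 by rewrite /c imset_f.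
have c_T x : x \in T -> c x = line_sign u q x.
  by move/T_pillar; rewrite inE => /andP[xq _]; rewrite /c (negPf xq).
have dTq x k : x \in T -> k \notin M ->
    line_sign u q x * dot (u x) (u (q k)) = 1 / 5.
  move=> /T_pillar; rewrite inE => /andP[xq /eqP xM] kM.
  by rewrite -dotZl dot_line_sign // xM (negPf kM) mulr0 subr0.
have dTT x y : x \in T -> y \in T -> x != y ->
    line_sign u q x * line_sign u q y * dot (u x) (u y) = - (1 / 5).
  rewrite !inE => /orP[/orP[]|] /eqP -> /orP[/orP[]|] /eqP ->;
    rewrite ?eqxx // => _; try lra;
    rewrite dotC [X in X * _]mulrC; lra.
have T3 : #|T| = 3%N.
  by rewrite /T -setUA cardsU1 cards2 jl !inE negb_or ij eq_sym li.
have Q3 : #|Q| = 3%N.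
  rewrite card_imset; last exact: system_inj sys.
  by apply: (@addnI #|M|); rewrite cardsC card_ord M2.
have TQ : T :&: Q = set0.
  apply/setP => x; rewrite !inE; apply/negbTE/negP => /andP[xT /imsetP[k _ xk]].
  have : x \in T by rewrite !inE.
  by move/T_pillar; rewrite inE xk imset_f.
have := system_max sys (c := c) (S := T :|: Q).
rewrite cardsU TQ cards0 T3 Q3 => H.
suff : (3 + 3 - 0 <= 5)%N by [].
apply: H.
  move=> x; rewrite /c; case: ifP => _; first by right.
  exact: line_sign_pm1.
move=> x y /setUP[xT|/imsetP[k kM ->]] /setUP[yT|/imsetP[m mM ->]] xy.
- by rewrite !c_T // dTT.
- rewrite c_q (c_T x) // mulrAC dTq //; last by rewrite inE in mM.
  by rewrite mulrN1.
- rewrite c_q (c_T y) // -mulrA dotC dTq //; last by rewrite inE in kM.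
  by rewrite mulN1r.
- rewrite !c_q (system_clique sys); first lra.
  by apply: contraNneq xy => ->.
Qed.

Definition residual_mx (R : realType) d n (u : 'I_n -> 'rV[R]_d)
    (q : 'I_5 -> 'I_n) m (f : 'I_m -> 'I_n) (c : R) : 'M[R]_(m, d) :=
  \matrix_(k < m) (c *: line_residual u q (f k)).

Lemma residual_mx_gramE (R : realType) d n (u : 'I_n -> 'rV[R]_d) q m l
    (f : 'I_m -> 'I_n) (g : 'I_l -> 'I_n) (a b : R) i j :
  (residual_mx u q f a *m (residual_mx u q g b)^T) i j =
  a * b * dot (line_residual u q (f i)) (line_residual u q (g j)).
Proof. by rewrite row_gramE dotZl dotZr mulrA. Qed.

Lemma residual_mx_pillar (R : realType) d n (u : 'I_n -> 'rV[R]_d) q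
    (M : {set 'I_5}) m (f : 'I_m -> 'I_n) (c : R) :
  clique_system u q -> #|M| = 2%N -> injective f ->
  (forall k, f k \in pillar_set u q M) -> c * c = 1 ->
  pillar (residual_mx u q f c) /\ triangle_free (residual_mx u q f c).
Proof.
move=> sys M2 f_inj fM cc.
have gE i j : (residual_mx u q f c *m (residual_mx u q f c)^T) i j =
    dot (line_residual u q (f i)) (line_residual u q (f j)).
  by rewrite residual_mx_gramE cc mul1r.
have diag i : (residual_mx u q f c *m (residual_mx u q f c)^T) i i = 2.
  by rewrite gE (line_residual_self (M := M)).
have pil : pillar (residual_mx u q f c).
  split=> // i j ij.
  have fij : f i != f j by apply: contra_neq ij => /f_inj.
  rewrite gE (line_residual_pillar (M := M)) //.
  by case: (signed_dot_pm sys fij) => ->; [left | right]; field.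
split=> // i j k.
(* The diagonal of the adjacency matrix is 0, so a nonzero triple product comes from three distinct
   lines. *)
have adj1 x y : pillar_adj (residual_mx u q f c) x y = 1 -> f x != f y /\
    dot (line_residual u q (f x)) (line_residual u q (f y)) = - 1.
  rewrite pillar_adjE gE; have [->|xy] := eqVneq x y.
    by rewrite -gE diag mulr1n subrr => /eqP; rewrite eq_sym oner_eq0.
  rewrite mulr0n sub0r => /(canRL (@opprK _)) ->; split=> //.
  by apply: contra_neq xy => /f_inj.
have [-> |] := pillar_adj01 i j pil; first by rewrite !mul0r.
have [-> |] := pillar_adj01 j k pil; first by rewrite mulr0 mul0r.
have [-> |] := pillar_adj01 k i pil; first by rewrite mulr0.
move=> /adj1[ki dki] /adj1[jk djk] /adj1[ij dij].
by case: (pillar_set_triangle sys M2 (fM i) (fM j) (fM k)).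
Qed.

(* The factor [c] is [-1] when the two minus sets are disjoint. *)
Lemma residual_mx_crossing (R : realType) d n (u : 'I_n -> 'rV[R]_d) q
    (M L : {set 'I_5}) m l (f : 'I_m -> 'I_n) (g : 'I_l -> 'I_n) :
  clique_system u q -> #|M| = 2%N -> #|L| = 2%N -> M != L ->
  (forall k, f k \in pillar_set u q M) ->
  (forall k, g k \in pillar_set u q L) ->
  exists2 c, c * c = 1 & crossing (residual_mx u q f 1) (residual_mx u q g c).
Proof.
move=> sys M2 L2 ML fM gL.
have ML1 : (#|M :&: L| <= 1)%N.
  rewrite leqNgt; apply: contra ML => ML2; rewrite eq_sym.
  have sML : M \subset L.
    by apply/setIidPl/eqP; rewrite eqEcard subsetIl M2.
  by rewrite eq_sym eqEcard sML M2 L2.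
have dE i j : exists2 s : R, s = 1 / 5 \/ s = - (1 / 5) &
    dot (line_residual u q (f i)) (line_residual u q (g j)) =
    5 / 2 * s - (4 * #|M :&: L|%:R - 2) / 12.
  exists (line_sign u q (f i) * line_sign u q (g j) * dot (u (f i)) (u (g j))).
    apply: signed_dot_pm => //; apply: contraNneq ML => fg.
    have := fM i; rewrite fg inE => /andP[_ /eqP <-].
    by have := gL j; rewrite inE => /andP[_ /eqP <-].
  have := fM i; rewrite inE => /andP[fq /eqP fM'].
  have := gL j; rewrite inE => /andP[gq /eqP gL'].
  by rewrite dot_line_residual // fM' gL' M2 L2; field.
(* Disjoint minus sets give products 2/3 and -1/3, hence the sign change; sets with one common
   element give 1/3 and -2/3 directly. *)
move: ML1; case: #|M :&: L| dE => [|[|//]] dE _.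
  exists (- 1); first by ring.
  move=> i j; rewrite residual_mx_gramE; case: (dE i j) => s s15 ->.
  by case: s15 => ->; [right | left]; field.
exists 1; first by ring.
move=> i j; rewrite residual_mx_gramE; case: (dE i j) => s s15 ->.
by case: s15 => ->; [left | right]; field.
Qed.

(** Selecting only [m] and [l] lines lets the exclusion lemmas for fixed sizes apply to larger
    pillars. *)
Lemma crossing_pillars (R : realType) d n (u : 'I_n -> 'rV[R]_d) q
    (M L : {set 'I_5}) (m l : nat) :
  clique_system u q -> #|M| = 2%N -> #|L| = 2%N -> M != L ->
  (m <= #|pillar_set u q M|)%N -> (l <= #|pillar_set u q L|)%N ->
  exists (A : 'M[R]_(m, d)) (B : 'M[R]_(l, d)),
    [/\ pillar A, triangle_free A, pillar B, triangle_free B & crossing A B].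
Proof.
move=> sys M2 L2 ML /exists_inj_ord[f f_inj fM] /exists_inj_ord[g g_inj gL].
have [c cc AB] := residual_mx_crossing sys M2 L2 ML fM gL.
have [pA tA] := residual_mx_pillar sys M2 f_inj fM (mulr1 1).
have [pB tB] := residual_mx_pillar sys L2 g_inj gL cc.
by exists (residual_mx u q f 1), (residual_mx u q g c).
Qed.

(** * Counting the lines of a system *)

Lemma clique_system_size (R : realType) d n (u : 'I_n -> 'rV[R]_d) q :
  clique_system u q -> (n <= maxn 276 ((4 * d + 36) %/ 3))%N.
Proof.
move=> sys.
pose S : {set {set 'I_5}} := [set M : {set 'I_5} | #|M| == 2%N].
have S10 : #|S| = 10%N by rewrite card_draws card_ord.
pose P (M : {set 'I_5}) := #|pillar_set u q M|.
have S2 (M : {set 'I_5}) : M \in S -> #|M| = 2%N by rewrite inE => /eqP.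
have P72 M L : M \in S -> L \in S -> M != L -> (0 < P L -> P M <= 72)%N.
  move=> /S2 M2 /S2 L2 ML PL.
  have [A [B [pA _ pB _ AB]]] := crossing_pillars sys M2 L2 ML (leqnn _) PL.
  exact: crossing_size_le pA pB AB.
have P41 M L : M \in S -> L \in S -> M != L -> (22 <= P L -> P M <= 41)%N.
  move=> /S2 M2 /S2 L2 ML PL; rewrite leqNgt; apply/negP => PM.
  have [A [B [pA _ pB _ AB]]] := crossing_pillars sys M2 L2 ML PM PL.
  exact: no_pillars42_22 pA pB AB.
have P25 M L : M \in S -> L \in S -> M != L -> (26 <= P L -> P M <= 25)%N.
  move=> /S2 M2 /S2 L2 ML PL; rewrite leqNgt; apply/negP => PM.
  have [A [B [pA tA pB tB AB]]] := crossing_pillars sys M2 L2 ML PM PL.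
  exact: no_pillars26_26 pA pB tA tB AB.
pose K := q @: setT.
pose T1 := [set i in ~: K | #|minus_set u q i| != 2%N].
pose T2 := [set i in ~: K | #|minus_set u q i| == 2%N].
have K5 : #|K| = 5%N.
  by rewrite card_imset ?cardsT ?card_ord //; apply: system_inj sys.
have nE : n = (5 + (#|T1| + #|T2|))%N.
  rewrite -{1}(card_ord n) -(cardsC K) K5; congr (5 + _)%N.
  rewrite -(cardsID [set i | #|minus_set u q i| != 2%N] (~: K)).
  congr (_ + _)%N.
    by apply: eq_card => i; rewrite !inE.
  by apply: eq_card => i; rewrite !inE negbK andbC.
have T1_5 : (#|T1| <= 5)%N.
  have T1P i : i \in T1 -> i \notin K /\ #|minus_set u q i| = 1%N.
    rewrite !inE => /andP[iK i2]; split=> //.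
    have := minus_set_le2 u q i; have := minus_set_neq0 sys iK.
    by case: #|_| i2 => [|[|[|]]].
  apply: (@acute_size_le5 _ _ _ T1 (line_residual u q)).
    move=> i /T1P[iK i1]; rewrite dot_line_residual // line_sign_sqr.
    by rewrite (system_unit sys) setIid i1; field.
  move=> i j /T1P[iK i1] /T1P[jK j1] ij; rewrite dot_line_residual // i1 j1.
  (* The product is at most [1/2 - 10/12 = -1/3], a common element of the minus sets only lowering
     it. *)
  have := ler0n R #|minus_set u q i :&: minus_set u q j|.
  by case: (signed_dot_pm sys ij) => ->; lra.
have T2E : #|T2| = (\sum_(M in S) P M)%N.
  rewrite -sum1_card (partition_big (minus_set u q) (mem S)) /=.
    apply: eq_bigr => M MS; rewrite sum1_card; apply: eq_card => i.
    rewrite unfold_in !inE; have [->|] := eqVneq (minus_set u q i) M;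
      rewrite ?andbF //.
    by rewrite (S2 M MS) eqxx !andbT.
  by move=> i; rewrite !inE => /andP[].
have [T266|[M MS T2P]] := sum_pillars_le S10 P72 P41 P25.
  by rewrite leq_max; apply/orP; left; lia.
have [f f_inj fM] := exists_inj_ord (leqnn (P M)).
have [pA tA] := residual_mx_pillar sys (S2 M MS) f_inj fM (mulr1 1).
have := pillar_size_le pA tA.
(* Here [n <= 10 + P M] and [3 P M <= 4 d], so [3 n <= 4 d + 30]. *)
by rewrite leq_max => Pd; apply/orP; right; rewrite leq_divRL //; lia.
Qed.

(** * From the base size to a system of lines *)

Lemma induced_clique_system (R : realType) d (U : {fset {vspace 'rV[R]_d}}) :
  is_base_size (5%:R^-1 : R) U 5 ->
  exists (u : 'I_#|` U| -> 'rV[R]_d) (q : 'I_5 -> 'I_#|` U|),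
    clique_system u q.
Proof.
case=> -[H [u [u1 uU] gram_u] H5] Hmax.
have dotH i j : dot (u i) (u j) =
    (i == j)%:R + (1 - (i == j)%:R - 2 * (H i j)%:R) / 5.
  by have /matrixP/(_ i j) := gram_u; rewrite !mxE => ->; rewrite mulrC.
have [Q Qcl Q5] : exists2 Q, clique H Q & #|Q| = 5%N.
  (* The empty clique ensures that the maximum defining the clique number is attained. *)
  have cl0 : clique H set0 by apply/forall_inP => i; rewrite inE.
  have [Q Qcl Qmax] := @eq_bigmax_cond _ (clique H) (fun Q => #|Q|)
    (introT card_gt0P (ex_intro _ set0 cl0)).
  by exists Q => //; rewrite -H5 /clique_number Qmax.
have [q q_inj qQ] := exists_inj_ord (eq_leq (esym Q5)).
exists u, q; split=> //.
- move=> i j ij; rewrite dotH (negPf ij).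
  by case: (H i j); [right | left]; rewrite /=; field.
- move=> k l kl; have qkl : q k != q l by apply: contra_neq kl => /q_inj.
  rewrite dotH (negPf qkl).
  move/forall_inP: Qcl => /(_ _ (qQ k))/forall_inP/(_ _ (qQ l)).
  by rewrite qkl /= => ->; rewrite /=; field.
move=> c S c1 cS.
have cc i : c i * c i = 1 by case: (c1 i) => ->; ring.
(* Off the diagonal the Seidel matrix is [1 - 2 A], so adjacency means a negative product. The signs
   [c] therefore yield another induced graph, in which [S] is a clique, and the base size bounds
   it. *)
pose e := [rel i j | (i != j) && (c i * c j * dot (u i) (u j) < 0)].
have e_sym : symmetric e.
  by move=> i j /=; rewrite eq_sym dotC [c i * _]mulrC.
have e_irr : irreflexive e by move=> i /=; rewrite eqxx.
have ind : induced_graph (5%:R^-1) (SGraph e_sym e_irr).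
  exists (fun i => c i *: u i).
    split=> [i|L]; first by rewrite /unit_vector dotZl dotZr mulrA cc mul1r u1.
    have line_c i : <[c i *: u i]>%VS = <[u i]>%VS.
      case: (c1 i) => ->; rewrite ?scale1r // scaleN1r; apply/eqP.
      rewrite eqEsubv -!memvE memvN memv_line /=.
      by rewrite -{1}(opprK (u i)) memvN memv_line.
    by rewrite uU; split=> -[i ->]; exists i; rewrite line_c.
  apply/matrixP => i j; rewrite !mxE /= dotZl dotZr mulrA.
  have [->|ij] := eqVneq i j; first by rewrite cc u1 /=; field.
  by rewrite dotH (negPf ij) /=; case: (c1 i) => ->; case: (c1 j) => ->;
    case: (H i j) => /=; case: ltP => /=; lra.
have Scl : clique (SGraph e_sym e_irr) S.
  apply/forall_inP => i iS; apply/forall_inP => j jS; apply/implyP => ij /=.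
  by rewrite ij cS //=; lra.
apply: leq_trans (Hmax _ ind).
exact: (@leq_bigmax_cond _ (clique (SGraph e_sym e_irr))
  (fun Q => #|pred_of_set Q|) S Scl).
Qed.

Theorem theorem1p2 (R : realType) (d n : nat) (U : {fset {vspace 'rV[R]_d}})
    (card_U : #|` U|%fset = n)
    (equi_U : equiangular U (acos (5%:R^-1 : R)))
    (base_U : is_base_size (5%:R^-1 : R) U 5) :
  (n <= maxn 276 ((4 * d + 36) %/ 3))%N.
Proof.
rewrite -card_U; have [u [q sys]] := induced_clique_system base_U.
exact: clique_system_size sys.
Qed.
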